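(* Let $n\ge 1$, let $p_1,\dots,p_n\in(0,1]$, and let $R_1=\sum_{i=1}^n\frac{p_i}{1-p_i}\in(0,\infty]$. The optimal strategy for Variant II is as follows: (1) if $R_1=1$, it is indifferent to predict that there will be no $1$'s or to play the standard game; (2) if $R_1>1$, then play the standard game; (3) if $R_1<1$, then predict that there will be no $1$'s. In any case, the probability of winning Variant II satisfies $\mathcal{V}^{**}(p_1,\dots,p_n)>\frac1e$.
   Context: Last-success (standard) game: independent Bernoulli variables $I_1,\dots,I_n$ with $P(I_i=1)=p_i>0$ are observed sequentially, and the player wins if he stops on the last variable equal to $1$. Put $q_i=1-p_i$, $r_i=p_i/q_i$ (with $r_i=\infty$ if $p_i=1$), $R_k=\sum_{i=k}^n r_i\in[0,\infty]$, $Q_k=\prod_{i=k}^n q_i$ (empty sum $=0$, empty product $=1$). The optimal threshold is $\mathbf{s}=\max\{1\le k\le n: R_k\ge 1\}$ if $R_1\ge 1$, and $\mathbf{s}=1$ otherwise. The optimal win probability of the standard game is $\mathcal{V}(p_1,\dots,p_n)=Q_{\mathbf{s}}R_{\mathbf{s}}$ if $p_{\mathbf{s}}<1$ and $\mathcal{V}(p_1,\dots,p_n)=Q_{\mathbf{s}+1}$ if $p_{\mathbf{s}}=1$. In Variant II the player, before observing any variable, chooses either to play the standard game (optimally), winning with probability $\mathcal{V}(p_1,\dots,p_n)$, or to predict that all the variables will equal $0$, winning with probability $Q_1$. Thus the probability of winning Variant II under optimal play is $\mathcal{V}^{**}(p_1,\dots,p_n)=\max\{Q_1,\mathcal{V}(p_1,\dots,p_n)\}$.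 ''Indifferent'' means $Q_1=\mathcal{V}(p_1,\dots,p_n)$; ''play the standard game'' means that $\mathcal{V}(p_1,\dots,p_n)>Q_1$; ''predict that there will be no $1$'s'' means that $Q_1>\mathcal{V}(p_1,\dots,p_n)$. *)

(* Defs.v *)
From HB Require Import structures.
From mathcomp Require Import all_boot all_order all_algebra.
From mathcomp Require Import all_classical all_reals all_analysis.

Set Implicit Arguments.
Unset Strict Implicit.
Unset Printing Implicit Defensive.

Import Order.TTheory GRing.Theory Num.Theory.

Local Open Scope ring_scope.

(* The data p_1, ..., p_n are carried by a sequence p : nat -> R of which only
   the values at the indices 1, ..., n are read. *)

Definition odds (R : realType) (x : R) : \bar R :=
  if x == 1 then +oo%E else (x / (1 - x))%:E.

Definition odds_sum (R : realType) (n : nat) (p : nat -> R) (k : nat) : \bar R :=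
  (\sum_(k <= i < n.+1) odds (p i))%E.

Definition fail_prod (R : realType) (n : nat) (p : nat -> R) (k : nat) : R :=
  \prod_(k <= i < n.+1) (1 - p i).

Definition threshold (R : realType) (n : nat) (p : nat -> R) : nat :=
  if (1%E <= odds_sum n p 1)%E
  then \max_(1 <= k < n.+1 | (1%E <= odds_sum n p k)%E) k
  else 1%N.

(* Optimal win probability of the standard (last-success) game. If p_s < 1 at
   the threshold s, then R_s is finite: an index j > s with p_j = 1 would give
   R_j = +oo >= 1, against the maximality of s. So [fine] loses nothing here. *)
Definition win_std (R : realType) (n : nat) (p : nat -> R) : R :=
  let s := threshold n p in
  if p s < 1 then fail_prod n p s * fine (odds_sum n p s)
  else fail_prod n p s.+1.

Definition win_variant2 (R : realType) (n : nat) (p : nat -> R) : R :=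
  Num.max (fail_prod n p 1) (win_std n p).

(* Main.v *)
(** Since 1 - x = 1/(1 + r) for r = x/(1 - x), and 1 + r <= e^r, one gets
    Q_k >= e^(- R_k) as soon as R_k is finite. If R_1 >= 1, the threshold s
    satisfies R_s >= 1 > R_(s+1). If p_s = 1, the win probability Q_(s+1)
    exceeds 1/e. Otherwise put r = r_s, t = R_(s+1) and u = 1 - t, so that
    0 < u <= r; then
      Q_s R_s >= (r + t)/(1 + r) e^(-t) >= e^(-t)/(1 + u) > e^(-t-u) = 1/e. *)
Require Import Defs.
From HB Require Import structures.
From mathcomp Require Import all_boot all_order all_algebra.
From mathcomp Require Import all_classical all_reals all_analysis.
From mathcomp Require Import ring lra.

Import Order.TTheory GRing.Theory Num.Theory.

Local Open Scope ring_scope.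

Lemma odds_lt1 (R : realType) (x : R) : x < 1 -> odds x = (x / (1 - x))%:E.
Proof. by move=> x1; rewrite /odds lt_eqF. Qed.

Lemma odds_gt0 (R : realType) (x : R) : 0 < x <= 1 -> (0 < odds x)%E.
Proof.
move=> /andP[x0 x1]; rewrite /odds; case: eqP => [_|/eqP xN1]; first exact: ltey.
by rewrite lte_fin divr_gt0// subr_gt0 lt_neqAle xN1.
Qed.

Lemma expRN_odds_le (R : realType) (x : R) :
  x < 1 -> expR (- (x / (1 - x))) <= 1 - x.
Proof.
move=> x1; have q0 : 0 < 1 - x by rewrite subr_gt0.
rewrite expRN -[leRHS]invrK lef_pV2 ?posrE ?expR_gt0 ?invr_gt0//.
rewrite [leLHS](_ : _ = 1 + x / (1 - x)); last by field; rewrite gt_eqF.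
exact: expR_ge1Dx.
Qed.

Section OddsSum.
Set Implicit Arguments.
Unset Strict Implicit.

Variables (R : realType) (n : nat) (p : nat -> R).
Hypothesis hp : forall i : nat, (1 <= i <= n)%N -> 0 < p i <= 1.

Lemma odds_sum_recl k : (k <= n)%N ->
  odds_sum n p k = (odds (p k) + odds_sum n p k.+1)%E.
Proof. by move=> kn; rewrite /odds_sum big_ltn. Qed.

Lemma fail_prod_recl k : (k <= n)%N ->
  fail_prod n p k = (1 - p k) * fail_prod n p k.+1.
Proof. by move=> kn; rewrite /fail_prod big_ltn. Qed.

Lemma odds_sum_ge0 k : (1 <= k)%N -> (0 <= odds_sum n p k)%E.
Proof.
move=> k1; rewrite /odds_sum big_nat; apply: sume_ge0 => i /andP[ki iltn].
by apply/ltW/odds_gt0/hp; rewrite (leq_trans k1 ki).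
Qed.

Lemma odds_sum_fin k : (1 <= k)%N -> (odds_sum n p k < +oo)%E ->
  odds_sum n p k = (fine (odds_sum n p k))%:E.
Proof. by move=> k1 fk; rewrite fineK// ge0_fin_numE// odds_sum_ge0. Qed.

(** A summand [+oo] could only be absorbed by [-oo], which the nonnegativity of the tail excludes;
    so finiteness passes to both the head and the tail. *)
Lemma odds_sum_lty k : (1 <= k <= n)%N ->
  (odds_sum n p k < +oo)%E -> p k < 1 /\ (odds_sum n p k.+1 < +oo)%E.
Proof.
move=> /[dup] kn /andP[k1 kn']; have /andP[_ pk1] := hp kn.
rewrite odds_sum_recl// [p k < 1]lt_neqAle pk1 andbT /odds.
case: eqP => /= _.
  by rewrite addye ?ltxx// gt_eqF// (lt_le_trans _ (odds_sum_ge0 (k := k.+1) isT)).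
case: (odds_sum n p k.+1) => [r| |]//= _; split; rewrite ?ltry ?ltNyr//.
Qed.

Lemma fine_odds_sum_recl k : (1 <= k <= n)%N ->
  p k < 1 -> (odds_sum n p k.+1 < +oo)%E ->
  odds_sum n p k = (p k / (1 - p k) + fine (odds_sum n p k.+1))%:E.
Proof.
move=> /andP[_ kn] pk1 fk.
by rewrite odds_sum_recl// odds_lt1// {1}odds_sum_fin// EFinD.
Qed.

Lemma fail_prod_ge_expR k : (1 <= k <= n.+1)%N -> (odds_sum n p k < +oo)%E ->
  expR (- fine (odds_sum n p k)) <= fail_prod n p k.
Proof.
(* Induction on the number [n.+1 - k] of factors, starting from the empty product at [k = n.+1]. *)
move=> /andP[+ kn]; rewrite -(subKn kn).
elim: (n.+1 - k)%N (leq_subr k n.+1) => [_ _ _|d IH dn k1 fk].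
  by rewrite subn0 /odds_sum /fail_prod !big_geq//= oppr0 expR0.
have e : (n.+1 - d.+1).+1 = (n.+1 - d)%N by rewrite subSS subSn.
have kd : (1 <= n.+1 - d.+1 <= n)%N by rewrite k1 subSS leq_subr.
have [pk1 fk1] := odds_sum_lty kd fk.
rewrite (fine_odds_sum_recl kd)//= fail_prod_recl; last by case/andP: kd.
rewrite opprD expRD; apply: ler_pM; rewrite ?expR_ge0 ?expRN_odds_le//.
by rewrite e in fk1 *; apply: IH => //; [exact: ltnW | rewrite -e].
Qed.

Lemma fail_prod_ge0 k : (1 <= k)%N -> 0 <= fail_prod n p k.
Proof.
move=> k1; rewrite /fail_prod big_nat; apply: prodr_ge0 => i /andP[ki iltn].
by rewrite subr_ge0; have /andP[] : 0 < p i <= 1 by rewrite hp// (leq_trans k1 ki).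
Qed.

Lemma fail_prod_homo i j : (1 <= i)%N -> (i <= j <= n.+1)%N ->
  fail_prod n p i <= fail_prod n p j.
Proof.
move=> i1 /andP[ij jn]; rewrite /fail_prod (big_cat_nat ij jn)/=.
rewrite -[leRHS]mul1r ler_wpM2r ?fail_prod_ge0 ?(leq_trans i1)//.
rewrite big_nat; apply: prodr_ile1 => l /andP[il lj].
have /hp : (1 <= l <= n)%N by rewrite (leq_trans i1)// -ltnS (leq_trans lj).
by move=> /andP[pl0 pl1]; rewrite subr_ge0 pl1 gerBl ltW.
Qed.

(** Strictness comes from the single factor [1 - p i < 1]. Positivity at [j] is essential: a later
    [p l = 1] would make both products zero. *)
Lemma fail_prod_lt i j : (1 <= i)%N -> (i < j <= n.+1)%N ->
  0 < fail_prod n p j -> fail_prod n p i < fail_prod n p j.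
Proof.
move=> i1 /andP[ij jn] Qj0; have iln : (i <= n)%N by rewrite -ltnS (leq_trans ij).
have /andP[pi0 pi1] : 0 < p i <= 1 by rewrite hp// i1.
rewrite fail_prod_recl// (@le_lt_trans _ _ ((1 - p i) * fail_prod n p j))//.
  by rewrite ler_wpM2l ?subr_ge0// fail_prod_homo ?ij.
by rewrite gtr_pMl// gtrBl.
Qed.

Lemma odds_sum_anti i j : (1 <= i)%N -> (i <= j <= n.+1)%N ->
  (odds_sum n p j <= odds_sum n p i)%E.
Proof.
move=> i1 /andP[ij jn]; rewrite /odds_sum [leRHS](big_cat_nat ij jn)/=.
apply: leeDr; rewrite big_nat; apply: sume_ge0 => l /andP[il lj].
by apply/ltW/odds_gt0/hp; rewrite (leq_trans i1)// -ltnS (leq_trans lj).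
Qed.

Lemma fail_prod_gt_expRN1 k : (1 <= k <= n.+1)%N -> (odds_sum n p k < 1)%E ->
  (expR 1)^-1 < fail_prod n p k.
Proof.
move=> kn Rk1; have Rky : (odds_sum n p k < +oo)%E by apply: lt_trans Rk1 (ltey _).
apply: lt_le_trans (fail_prod_ge_expR kn Rky).
rewrite -expRN ltr_expR ltrN2 -lte_fin -odds_sum_fin//; by case/andP: kn.
Qed.

(** This is the only form in which the maximum is used: the odds sum crosses 1 between [s] and
    [s.+1]. *)
Lemma thresholdP : (1 <= n)%N -> (1 <= odds_sum n p 1)%E ->
  [/\ (1 <= threshold n p <= n)%N, (1 <= odds_sum n p (threshold n p))%E
    & (odds_sum n p (threshold n p).+1 < 1)%E].
Proof.
move=> n1 R1; rewrite /threshold R1.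
set s := (\max_(_ <= _ < _ | _) _)%N.
have sub k : (1 <= k <= n)%N -> (1 <= odds_sum n p k)%E -> (k <= s)%N.
  by move=> kn Rk; apply: leq_bigmax_seq => //; rewrite mem_index_iota ltnS.
have s1 : (1 <= s)%N by apply: sub.
have [s0|/andP[sn Rs]] : s = 0%N \/ ((s <= n)%N && (1 <= odds_sum n p s)%E).
(* The maximum is either attained at an admissible index or equal to the default 0 of an empty
   range; the latter contradicts [s1]. *)
- rewrite /s big_nat_cond; apply: (big_ind (fun m : nat =>
    m = 0%N \/ ((m <= n)%N && (1 <= odds_sum n p m)%E))); first by left.
  + by move=> x y hx hy; rewrite /maxn; case: ifP.
  + by move=> i /andP[/andP[_ iltn] Ri]; right; rewrite -ltnS iltn.
- by rewrite s0 in s1.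
split; rewrite ?s1//.
(* If [s = n], the next sum is empty; otherwise maximality of [s] applies to [s.+1]. *)
have [sltn|nles] := ltnP s n; last by rewrite /odds_sum big_geq// lte01.
by rewrite ltNge; apply/negP => /(sub s.+1 sltn); rewrite ltnn.
Qed.

Lemma win_std_gt_expRN1 : (1 <= n)%N -> (1 <= odds_sum n p 1)%E ->
  (expR 1)^-1 < win_std n p.
Proof.
move=> n1 R1; rewrite /win_std.
have [sn Rs Rs1] := thresholdP n1 R1; move: (threshold n p) sn Rs Rs1 => s.
move=> /[dup] sn /andP[s1 sn'] Rs Rs1.
have [ps1|_] := ifPn; last by apply: fail_prod_gt_expRN1.
have Rs1y : (odds_sum n p s.+1 < +oo)%E by apply: lt_trans Rs1 (ltey _).
have := fail_prod_ge_expR (k := s.+1) sn' Rs1y.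
move: Rs; rewrite (fine_odds_sum_recl sn)// lee_fin (fail_prod_recl sn')//=.
move: Rs1; rewrite {1}odds_sum_fin// lte_fin.
move: (fine _) (fail_prod _ _ _) => t Q t1 rt1 Qt.
have q0 : 0 < 1 - p s by rewrite subr_gt0.
have qR : (1 - p s) * (p s / (1 - p s) + t) = p s + (1 - p s) * t.
  by rewrite mulrDr mulrCA divff ?mulr1// gt_eqF.
have rt1' : 1 - p s <= p s + (1 - p s) * t.
  by rewrite -qR -[leLHS]mulr1 ler_pM2l.
rewrite mulrAC qR.
have u0 : 0 < 2 - t by lra.
apply: (@lt_le_trans _ _ ((2 - t)^-1 * expR (- t))); last first.
  (* With [q = 1 - p s] and [u = 1 - t], the right side is [1 - q * u], and [(1 - q * u) * (1 + u) =
     1 + u * (p s - q * u)]. The last bracket is nonnegative by [rt1']. *)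
  have u1 : (2 - t)^-1 <= p s + (1 - p s) * t.
    by rewrite -[leLHS]mul1r ler_pdivrMr//; nra.
  by apply: ler_pM; rewrite ?invr_ge0 ?expR_ge0 ?(ltW u0).
have -> : (expR 1)^-1 = (expR (1 - t))^-1 * expR (- t) :> R.
  by rewrite -!expRN -expRD; congr expR; lra.
rewrite ltr_pM2r ?expR_gt0// ltf_pV2 ?posrE ?expR_gt0//.
have -> : 2 - t = 1 + (1 - t) by lra.
by apply: expR_gt1Dx; rewrite gt_eqF// subr_gt0.
Qed.

End OddsSum.

Theorem theorem11 (R : realType) (n : nat) (p : nat -> R)
    (hn : (1 <= n)%N)
    (hp : forall i : nat, (1 <= i <= n)%N -> 0 < p i <= 1) :
  [/\ (odds_sum n p 1 = 1%E -> fail_prod n p 1 = win_std n p),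
      ((1%E < odds_sum n p 1)%E -> fail_prod n p 1 < win_std n p),
      ((odds_sum n p 1 < 1%E)%E -> win_std n p < fail_prod n p 1)
    & (expR 1)^-1 < win_variant2 n p].
Proof.
have h1n : (1 <= 1 <= n)%N by [].
have h1n1 : (1 <= 1 <= n.+1)%N by [].
have e0 : 0 < (expR 1)^-1 :> R by rewrite invr_gt0 expR_gt0.
split.
- move=> R1; have R1y : (odds_sum n p 1 < +oo)%E by rewrite R1 ltey.
  have [p1 R2y] := odds_sum_lty hp h1n R1y.
  have R1ge1 : (1 <= odds_sum n p 1)%E by rewrite R1.
  (* Since [p 1 > 0], dropping the first odds brings the sum strictly below 1. This forces the
     threshold to be 1, so the win probability is [fail_prod n p 1] times 1. *)
  have R2lt1 : (odds_sum n p 2 < 1)%E.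
    have [p10 _] := andP (hp 1%N h1n).
    rewrite -R1 (fine_odds_sum_recl hp h1n p1 R2y) {1}(odds_sum_fin hp _ R2y)//.
    by rewrite lte_fin ltrDr divr_gt0// subr_gt0.
  have [/andP[s1 sn] Rs _] := thresholdP hn R1ge1.
  have th1 : threshold n p = 1%N.
    apply/eqP; rewrite eqn_leq s1 andbT leqNgt; apply/negP => s2.
    have R2s : (odds_sum n p (threshold n p) <= odds_sum n p 2)%E.
      by apply: (odds_sum_anti hp); rewrite // s2 leqW.
    by have := le_lt_trans (le_trans Rs R2s) R2lt1; rewrite ltxx.
  by rewrite /win_std th1 p1 R1 mulr1.
- move=> R1; have := thresholdP hn (ltW R1); rewrite /win_std.
  move: (threshold n p) => s [/[dup] sn /andP[s1 sn'] Rs Rs1].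
  have Rs1y : (odds_sum n p s.+1 < +oo)%E by apply: lt_trans Rs1 (ltey _).
  have [ps1|ps1] := ifPn; last first.
    (* When [p s = 1], the product from 1 vanishes, while the one from [s.+1] exceeds [1/e]. *)
    have Qs1 : 0 < fail_prod n p s.+1.
      by rewrite (lt_trans e0)// (fail_prod_gt_expRN1 hp).
    by rewrite (fail_prod_lt hp).
  have Rsy : (odds_sum n p s < +oo)%E.
    by rewrite (fine_odds_sum_recl hp sn ps1 Rs1y) ltey.
  have Qs0 : 0 < fail_prod n p s.
    apply: lt_le_trans (expR_gt0 _) (fail_prod_ge_expR hp _ Rsy).
    by rewrite s1 leqW.
  (* The source of strictness depends on [s]. For [s = 1] it is the assumption that the sum from 1
     exceeds 1. For [s > 1] the sum from [s] may equal 1, and strictness comes from the product,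
     which loses the factors before [s]. *)
  move: s1; rewrite leq_eqVlt => /predU1P[s1|s1].
    rewrite -s1 in Qs0 Rsy *.
    by rewrite ltr_pMr// -lte_fin -(odds_sum_fin hp).
  apply: (@lt_le_trans _ _ (fail_prod n p s)).
    by apply: (fail_prod_lt hp); rewrite // s1 leqW.
  rewrite ler_pMr// -lee_fin -(odds_sum_fin hp)//; exact: ltnW.
- move=> R1; have R1y : (odds_sum n p 1 < +oo)%E by apply: lt_trans R1 (ltey _).
  have [p1 _] := odds_sum_lty hp h1n R1y.
  (* The threshold takes its default value 1, so both strategies share the positive factor
     [fail_prod n p 1]. *)
  rewrite /win_std /threshold leNgt R1 /= p1 -[ltRHS]mulr1 ltr_pM2l.
    by rewrite -lte_fin -odds_sum_fin.
  exact: lt_trans e0 (fail_prod_gt_expRN1 hp h1n1 R1).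
- rewrite /win_variant2 lt_max.
  (* Below 1 the all-zeros prediction already beats [1/e]; from 1 on, the standard game does. *)
  have [R1|R1] := ltP (odds_sum n p 1) 1%E.
    by rewrite fail_prod_gt_expRN1.
  by rewrite win_std_gt_expRN1 ?orbT.
Qed.
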